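(* Let $\mathcal{H}$ be an infinite-dimensional separable Hilbert space. Any complete sequence $(f_n)$ in $\mathcal{H}$ whose analysis operator has finite-dimensional domain is a lower semi frame for $\mathcal{H}$ (and thus, for every $A\in(0,\infty)$, there exists $(\omega_n)\subset(0,\infty)$ such that $(\omega_nf_n)$ is a lower semi frame for $\mathcal{H}$ with bound $A$).
   Context: All sequences are indexed by $\mathbb{N}$. A sequence in $\mathcal{H}$ is complete in $\mathcal{H}$ if its linear span is dense in $\mathcal{H}$. The analysis operator of $(f_n)$ is $C:\mathcal{D}(C)\subseteq\mathcal{H}\to\ell^2$, $Cf=(\langle f,f_n\rangle)$, with domain $\mathcal{D}(C)=\{f\in\mathcal{H}:\sum_n|\langle f,f_n\rangle|^2<\infty\}$. A sequence $(f_n)$ is a lower semi frame for $\mathcal{H}$ with bound $A>0$ if $A\|f\|^2\le\sum_n|\langle f,f_n\rangle|^2$ for all $f\in\mathcal{H}$ (the sum may be $+\infty$); it is a lower semi frame if this holds for some $A>0$. *)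

(* Defs.v *)
From HB Require Import structures.
From mathcomp Require Import all_boot all_order all_algebra.
From mathcomp Require Export sesquilinear.
From mathcomp Require Import all_classical all_reals all_analysis.
From mathcomp Require Import complex.

Set Implicit Arguments.
Unset Strict Implicit.
Unset Printing Implicit Defensive.

Import Order.TTheory GRing.Theory Num.Theory.
Import numFieldNormedType.Exports.

Local Open Scope classical_set_scope.
Local Open Scope ring_scope.
Local Open Scope complex_scope.

(* Hilbert spaces are taken over the real or the complex numbers alike. *)
Variant scalar_kind := RealScalars | ComplexScalars.

Definition scalar_field (R : realType) (k : scalar_kind) : numFieldType :=
  match k with RealScalars => R | ComplexScalars => R[i] end.

Definition scalar_conj (R : realType) (k : scalar_kind) :
    scalar_field R k -> scalar_field R k :=
  match k with RealScalars => idfun | ComplexScalars => @conjc R end.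

Definition of_real (R : realType) (k : scalar_kind) : R -> scalar_field R k :=
  match k with RealScalars => idfun | ComplexScalars => real_complex R end.

Definition real_part (R : realType) (k : scalar_kind) : scalar_field R k -> R :=
  match k with RealScalars => idfun | ComplexScalars => @complex.Re R end.

(* MathComp norms take their values in the scalar field, hence in [R[i]] in
   the complex case; [rnorm] is the same norm read as an element of [R]. *)
Definition rnorm (R : realType) (k : scalar_kind)
    (V : normedZmodType (scalar_field R k)) (x : V) : R :=
  real_part `|x|.

(* The inner product is linear in its first argument, conjugate-linear in the
   second. *)
Definition induces_norm (R : realType) (k : scalar_kind)
    (H : normedModType (scalar_field R k)) (dot : {dot H for @scalar_conj R k}) :=
  forall x : H, `|x| ^+ 2 = dot x x.

Definition separable_space (T : topologicalType) :=
  exists2 D : set T, countable D & dense D.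

Definition linear_span (K : nzRingType) (V : lmodType K) (A : set V) : set V :=
  [set x | exists n (c : 'I_n -> K) (v : 'I_n -> V),
     (forall i, A (v i)) /\ x = \sum_i c i *: v i].

Definition finite_dimensional (K : nzRingType) (V : lmodType K) (W : set V) :=
  exists2 A : set V, finite_set A & W = linear_span A.

Definition complete_seq (K : numFieldType) (H : normedModType K)
    (f : nat -> H) :=
  dense (linear_span (range f)).

Section frames.
Context (R : realType) (k : scalar_kind) (H : normedModType (scalar_field R k)).
Context (dot : {dot H for @scalar_conj R k}).
Implicit Types (f : nat -> H) (A : R).
Local Open Scope ereal_scope.

Definition square_sum (u : nat -> scalar_field R k) : \bar R :=
  \sum_(0 <= n <oo) (rnorm (u n) ^+ 2)%:E.

Definition ell2 : set (nat -> scalar_field R k) := [set u | square_sum u < +oo].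

Definition analysis f (x : H) : nat -> scalar_field R k := fun n => dot x (f n).

Definition analysis_domain f : set H := [set x | ell2 (analysis f x)].

Definition lower_semi_frame_with f A :=
  (0 < A)%R /\
  forall x : H, (A * rnorm x ^+ 2)%:E <= square_sum (analysis f x).

Definition lower_semi_frame f := exists A, lower_semi_frame_with f A.

End frames.

(* Main.v *)
Require Import Defs.
From HB Require Import structures.
From mathcomp Require Import all_boot all_order all_algebra.
From mathcomp Require Import all_classical all_reals all_analysis.
From mathcomp Require Import complex.

(** Write [D] for the domain of the analysis operator and [Q x] for the sum of
    the squares [|<x, f_n>|^2]. Outside [D] the lower bound holds because
    [Q = +oo]. By completeness the functionals [<., f_n>] separate points, so
    on the finite-dimensional space [D] finitely many of them admit a
    reconstruction formula [x = \sum_p <x, f_(n_p)> h_p]. Since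
    [|<x, f_n>|^2 <= Q x], this gives [|x|^2 <= (\sum_p |h_p|)^2 Q x] on [D].
    A constant weight then turns any bound into any other one. *)

Set Implicit Arguments.
Unset Strict Implicit.
Unset Printing Implicit Defensive.

Import Order.TTheory GRing.Theory Num.Theory.
Import numFieldNormedType.Exports.

Local Open Scope classical_set_scope.
Local Open Scope ring_scope.

(** * Linear algebra: reconstruction from separating functionals *)

Section reconstruction.
Context (K : fieldType) (V : lmodType K) (I : Type) (phi : I -> {scalar V}).
Context (phi_separates : forall x, (forall i, phi i x = 0) -> x = 0).

(* If [v] is not reproduced and [phi m] does not vanish on the residue [q] of
   [v], the residue of any [x] is corrected by its component along [q], as
   measured by [phi m]. *)
Lemma seq_reconstruction (s : seq V) : exists r : seq (I * V),
  forall x, x \in s -> x = \sum_(p <- r) phi p.1 x *: p.2.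
Proof.
elim: s => [|v s [r rP]]; first by exists [::].
pose T x := \sum_(p <- r) phi p.1 x *: p.2.
have [Tv|/eqP q0] := eqVneq (v - T v) 0.
  by exists r => x; rewrite inE => /orP[/eqP ->|/rP//]; exact: subr0_eq.
have [m qm] : exists m, phi m (v - T v) != 0.
  apply: contrapT => /forallNP h; apply: q0; apply: phi_separates => m.
  by apply/eqP/negPn/negP/h.
set q := v - T v in q0 qm.
exists ((m, (phi m q)^-1 *: q) ::
  [seq (p.1, p.2 - (phi m p.2 / phi m q) *: q) | p <- r]) => x xs.
(* By linearity of [phi m], the multiples of [q] subtracted in the old terms add up to
   [(phi m (T x) / phi m q) *: q]. *)
have -> : \sum_(p <- (m, (phi m q)^-1 *: q) ::
    [seq (p.1, p.2 - (phi m p.2 / phi m q) *: q) | p <- r]) phi p.1 x *: p.2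
    = T x + (phi m (x - T x) / phi m q) *: q.
  rewrite big_cons big_map /=.
  under eq_bigr do rewrite scalerBr.
  rewrite sumrB -/(T x) addrCA; congr (_ + _).
  rewrite [phi m (x - _)]linearB mulrBl scalerBl scalerA; congr (_ - _).
  rewrite /T linear_sum mulr_suml scaler_suml.
  by apply: eq_bigr => p _; rewrite scalerA linearZ /= mulrA.
(* The residue of [v] is [q], so the correction is exactly [q]; on [s] the residue is already zero
   and nothing changes. *)
move: xs; rewrite inE => /orP[/eqP -> | /rP xE].
  by rewrite -/q divff// scale1r addrC subrK.
by rewrite -[T x]xE subrr linear0 mul0r scale0r addr0.
Qed.

(** Both sides of the formula are linear in [x], so it passes from a finite spanning set to its
    span. *)
Lemma finite_dimensional_reconstruction (W : set V) :
  finite_dimensional W -> exists r : seq (I * V),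
  forall x, W x -> x = \sum_(p <- r) phi p.1 x *: p.2.
Proof.
case=> A /finite_seqP[s ->] ->; have [r rP] := seq_reconstruction s.
exists r => x [n [c [v [vs ->]]]].
under [RHS]eq_bigr do rewrite linear_sum scaler_suml.
rewrite exchange_big; apply: eq_bigr => i _ /=.
rewrite {1}(rP _ (vs i)) scaler_sumr.
by apply: eq_bigr => p _; rewrite [phi _ (_ *: _)]linearZ /= scalerA.
Qed.

End reconstruction.

(** * Passing between [R] and the real or complex scalars *)

Section scalars.
Context (R : realType) (k : scalar_kind).
Implicit Types a b : scalar_field R k.

Lemma scalar_conj0 : scalar_conj (0 : scalar_field R k) = 0.
Proof. by case: k => //=; rewrite oppr0. Qed.

Lemma scalar_conj_of_real (w : R) : scalar_conj (of_real k w) = of_real k w.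
Proof. by case: k => //=; rewrite oppr0. Qed.

(** In the order on [R[i]], a nonnegative number has zero imaginary part. *)
Lemma real_partK a : 0 <= a -> of_real k (real_part a) = a.
Proof.
by case: k a => //= -[x y]; rewrite lecE /= => /andP[/eqP -> _].
Qed.

Lemma of_realK (x : R) : real_part (of_real k x) = x.
Proof. by case: k. Qed.

Lemma le_of_real (x y : R) : (of_real k x <= of_real k y) = (x <= y).
Proof. by case: k => //=; rewrite lecR. Qed.

Lemma of_realM (x y : R) : of_real k (x * y) = of_real k x * of_real k y.
Proof. by case: k => //=; rewrite rmorphM. Qed.

Lemma of_real_sum (J : Type) (s : seq J) (F : J -> R) :
  of_real k (\sum_(j <- s) F j) = \sum_(j <- s) of_real k (F j).
Proof. by case: k => //=; rewrite rmorph_sum. Qed.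

End scalars.

(** * Real-valued norms *)

Section real_norm.
Context (R : realType) (k : scalar_kind).

Lemma of_real_rnorm (V : normedZmodType (scalar_field R k)) (x : V) :
  of_real k (rnorm x) = `|x|.
Proof. exact: real_partK. Qed.

Lemma rnorm_ge0 (V : normedZmodType (scalar_field R k)) (x : V) :
  0 <= rnorm x.
Proof.
rewrite -(le_of_real k) of_real_rnorm.
by have -> : of_real k 0 = 0 by case: (k).
Qed.

Lemma rnorm_sum_le (V : normedModType (scalar_field R k)) (J : Type)
    (s : seq J) (c : J -> scalar_field R k) (h : J -> V) :
  rnorm (\sum_(j <- s) c j *: h j) <= \sum_(j <- s) rnorm (c j) * rnorm (h j).
Proof.
rewrite -(le_of_real k) of_real_sum of_real_rnorm.
apply: le_trans (ler_norm_sum _ _ _) _; apply: ler_sum => j _.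
by rewrite of_realM !of_real_rnorm normrZ.
Qed.

Lemma rnorm_of_realM (w : R) (a : scalar_field R k) : 0 <= w ->
  rnorm (of_real k w * a) = w * rnorm a.
Proof.
move=> w0; rewrite /rnorm normrM -/(rnorm _) ger0_norm; last first.
  by have := w0; rewrite -(le_of_real k); case: (k).
by rewrite -(of_real_rnorm a) -of_realM of_realK.
Qed.

End real_norm.

(** * Separation by completeness, and the lower frame bounds *)

Section lower_bound.
Context (R : realType) (k : scalar_kind) (H : normedModType (scalar_field R k)).
Context (dot : {dot H for @scalar_conj R k}) (f : nat -> H).

Lemma complete_seq_separates : induces_norm dot -> complete_seq f ->
  forall x, (forall n, dot x (f n) = 0) -> x = 0.
Proof.
move=> dot_norm fc x xf; apply: contrapT => /eqP x0.
have nx0 : 0 < `|x| by rewrite normr_gt0.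
have [y [xy [n [c [v [vf yE]]]]]] :
    (ball x `|x| `&` linear_span (range f)) !=set0.
  by apply: fc; [exists x; exact: ballxx | exact: ball_open].
have dxy : dot x y = 0.
  rewrite yE linear_sumr big1// => i _; have [m _ <-] := vf i.
  by rewrite linearZr_LR /= xf mulr0.
have dyx : dot y x = 0.
  by rewrite hermitian_subproof /= dxy scalar_conj0 mulr0.
(* Since [x] and [y] are orthogonal, Pythagoras gives [|x - y|^2 = |x|^2 + |y|^2], which keeps [y]
   out of the open ball of radius [|x|] around [x]. *)
suff xy_ge : `|x| <= `|x - y|.
  by move: xy; rewrite -ball_normE /= (le_gtF xy_ge).
rewrite -(@ler_pXn2r _ 2)// ?nnegrE// !dot_norm.
rewrite linearBl !linearBr /= dxy dyx subr0 sub0r opprK lerDl.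
by rewrite -dot_norm exprn_ge0.
Qed.

Lemma square_sum_ge_term (u : nat -> scalar_field R k) n :
  ((rnorm (u n) ^+ 2)%:E <= square_sum u)%E.
Proof.
rewrite /square_sum (@nneseriesD1 _ _ n xpredT)//; last first.
  by move=> m _; rewrite lee_fin sqr_ge0.
by rewrite leeDl// nneseries_ge0// => m _ _; rewrite lee_fin sqr_ge0.
Qed.

Lemma lower_semi_frame_of_reconstruction (r : seq (nat * H)) :
  (forall x, analysis_domain dot f x ->
     x = \sum_(p <- r) dot x (f p.1) *: p.2) ->
  lower_semi_frame dot f.
Proof.
move=> rP; pose C := \sum_(p <- r) rnorm p.2.
have C0 : 0 <= C by apply: sumr_ge0 => p _; exact: rnorm_ge0.
(* The [1 +] keeps the bound meaningful when the domain is [{0}]. *)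
have C1 : 0 < 1 + C ^+ 2 by rewrite ltr_pwDl// sqr_ge0.
exists (1 + C ^+ 2)^-1; split; first by rewrite invr_gt0.
move=> x; have [xD|xnD] := pselect (analysis_domain dot f x); last first.
  by have /negP := xnD; rewrite -leNgt leye_eq => /eqP ->; rewrite leey.
have term := square_sum_ge_term (analysis dot f x).
have Q0 : (0 <= square_sum (analysis dot f x))%E.
  by apply: le_trans (term 0); rewrite lee_fin sqr_ge0.
have /fineK Qfin : square_sum (analysis dot f x) \is a fin_num.
  by rewrite ge0_fin_numE.
rewrite -Qfin lee_fin; set S := fine _.
have tS n : rnorm (dot x (f n)) <= Num.sqrt S.
  have := term n; rewrite -Qfin lee_fin -/S => h.
  by rewrite -[leLHS]ger0_norm ?rnorm_ge0// -sqrtr_sqr ler_wsqrtr.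
have S0 : 0 <= S by exact: fine_ge0.
have xS : rnorm x <= Num.sqrt S * C.
  rewrite {1}(rP _ xD); apply: le_trans (rnorm_sum_le _ _ _) _.
  rewrite mulr_sumr; apply: ler_sum => p _.
  by rewrite ler_wpM2r ?rnorm_ge0.
(* It remains to chain [|x|^2 <= S * C^2 <= S * (1 + C^2)]. *)
rewrite mulrC ler_pdivrMr//.
apply: (@le_trans _ _ ((Num.sqrt S * C) ^+ 2)).
  by rewrite ler_pXn2r// nnegrE ?rnorm_ge0 ?mulr_ge0 ?sqrtr_ge0.
by rewrite exprMn sqr_sqrtr// mulrDr mulr1 lerDr.
Qed.

Lemma square_sum_analysis_scale (w : R) (x : H) : 0 <= w ->
  square_sum (analysis dot (fun n => of_real k w *: f n) x) =
  ((w ^+ 2)%:E * square_sum (analysis dot f x))%E.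
Proof.
move=> w0; rewrite /square_sum -nneseriesZl; last first.
  by move=> n _; rewrite lee_fin sqr_ge0.
apply: eq_eseriesr => n _.
rewrite /analysis linearZr_LR /= scalar_conj_of_real rnorm_of_realM//.
by rewrite exprMn EFinM.
Qed.

(** A constant weight [w] multiplies the square sum by [w^2], so [w = sqrt (A / B)] turns the bound
    [B] into [A]. *)
Lemma lower_semi_frame_rescale (A : R) : lower_semi_frame dot f -> 0 < A ->
  exists2 w : R, 0 < w &
    lower_semi_frame_with dot (fun n => of_real k w *: f n) A.
Proof.
move=> [B [B0 BP]] A0; exists (Num.sqrt (A / B)).
  by rewrite sqrtr_gt0 divr_gt0.
split=> // x; rewrite square_sum_analysis_scale ?sqrtr_ge0//.
rewrite sqr_sqrtr; last by rewrite divr_ge0// ltW.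
rewrite (_ : A * _ = (A / B) * (B * rnorm x ^+ 2)); last first.
  by rewrite mulrA divfK// gt_eqF.
by rewrite EFinM lee_pmul2l ?fin_numE// ?lte_fin ?divr_gt0.
Qed.

End lower_bound.

Theorem proposition3p7 (R : realType) (k : scalar_kind)
    (H : completeNormedModType (scalar_field R k))
    (dot : {dot H for @scalar_conj R k}) (dot_norm : induces_norm dot)
    (H_separable : separable_space H)
    (H_infinite : ~ finite_dimensional [set: H])
    (f : nat -> H) (f_complete : complete_seq f)
    (dom_finite : finite_dimensional (analysis_domain dot f)) :
  lower_semi_frame dot f /\
  forall A : R, 0 < A ->
    exists w : nat -> R, (forall n, 0 < w n) /\
      lower_semi_frame_with dot (fun n => of_real k (w n) *: f n) A.
Proof.
have frame : lower_semi_frame dot f.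
  (* [applyr dot (f n)] is [dot] with its second argument fixed, hence linear rather than
     conjugate-linear. *)
  have [r rP] := @finite_dimensional_reconstruction _ _ _
    (fun n => applyr dot (f n) : {scalar H})
    (complete_seq_separates dot_norm f_complete) _ dom_finite.
  exact: lower_semi_frame_of_reconstruction rP.
split=> // A A0; have [w w0 wP] := lower_semi_frame_rescale frame A0.
by exists (fun=> w).
Qed.
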